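(* Let $P\subset\mathbb{Q}^d$ be a distinct pair-sum polytope with $n:=|P\cap\mathbb{Z}^d|$. For any simple graph $G$ on $n$ nodes, there exists a set of moves $\mathcal{M}\subset\mathbb{Z}^d$ such that $G\cong P(\mathcal{M})$.
   Context: $\mathbb{N}=\{0,1,2,\dots\}$. Graphs are undirected, without loops or multiple edges. A polytope $P\subset\mathbb{Q}^d$ is a lattice polytope if all its vertices are in $\mathbb{Z}^d$. A lattice polytope $P\subset\mathbb{Q}^d$ with $n:=|P\cap\mathbb{Z}^d|$ is a distinct pair-sum polytope if the sumset $(P\cap\mathbb{Z}^d)+(P\cap\mathbb{Z}^d)$ has cardinality $\binom{n}{2}+n$. A finite set $\mathcal{M}\subset\mathbb{Z}^d\setminus\{0\}$ is a set of moves if $\mathcal{M}=-\mathcal{M}$ and if for all $\lambda\in\mathbb{N}$ with $\lambda\ge 2$ and all $m\in\mathcal{M}$, $\lambda\cdot m\notin\mathcal{M}$. For a lattice polytope $P\subset\mathbb{Q}^d$ and a set of moves $\mathcal{M}\subset\mathbb{Z}^d$, the fiber graph $P(\mathcal{M})$ is the graph with node set $P\cap\mathbb{Z}^d$ in which two nodes $u$ and $v$ are adjacent if $u-v\in\mathcal{M}$. *)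

(* Defs.v *)
From HB Require Import structures.
From mathcomp Require Import all_boot all_order all_algebra finmap.
From mathcomp Require Import boolp classical_sets cardinality.

Set Implicit Arguments.
Unset Strict Implicit.
Unset Printing Implicit Defensive.

Import Order.TTheory GRing.Theory Num.Theory.
Local Open Scope classical_set_scope.
Local Open Scope ring_scope.

(* Points of Q^d are row vectors ['rV[rat]_d]; points of Z^d
   are row vectors ['rV[int]_d], embedded in Q^d by [map_mx intr]. *)

Section Polytopes.
Variable d : nat.
Implicit Types (P F : set 'rV[rat]_d) (x v c : 'rV[rat]_d) (z m : 'rV[int]_d).

(* The points are the rows of V, w is the vector of barycentric weights. *)
Definition convex_hull (k : nat) (V : 'M[rat]_(k, d)) : set 'rV[rat]_d :=
  [set x | exists w : 'rV[rat]_k,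
     [/\ forall i, 0 <= w 0 i, \sum_i w 0 i = 1 & x = w *m V]].

Definition is_polytope P : Prop :=
  exists (k : nat) (V : 'M[rat]_(k, d)), P = convex_hull V.

Definition dotv c x : rat := \sum_i c 0 i * x 0 i.

(* c = 0 is allowed, so P itself (and the empty set) are faces, as usual. *)
Definition is_face P F : Prop :=
  exists (c : 'rV[rat]_d) (b : rat),
    (forall x, P x -> dotv c x <= b) /\ F = P `&` [set x | dotv c x = b].

Definition is_vertex P v : Prop := is_face P [set v].

Definition integral_point x : Prop :=
  exists z : 'rV[int]_d, x = map_mx intr z.

Record lattice_polytope : Type := LatticePolytope {
  polytope_set :> set 'rV[rat]_d;
  lattice_polytope_polytope : is_polytope polytope_set;
  lattice_polytope_vertices :
    forall v, is_vertex polytope_set v -> integral_point v }.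

(* [fset_set] sends infinite sets to the empty one; by [in_lattice_points]
   below this default value is never used. *)
Definition lattice_points (P : lattice_polytope) : {fset 'rV[int]_d} :=
  fset_set [set z | polytope_set P (map_mx intr z)].

Lemma polytope_finite_lattice P : is_polytope P ->
  finite_set [set z | P (map_mx intr z)].
Proof.
case=> k [V ->].
pose B : rat := \sum_i \sum_j `|V i j|.
have [N BN] : exists N : nat, B <= N%:R.
  by exists (Num.bound B); apply/ltW/archi_boundP; do 2!apply: sumr_ge0 => ? _.
pose f (a : 'rV['I_(N + N).+1]_d) : 'rV[int]_d :=
  \row_j ((a 0 j)%:Z - N%:Z).
apply: (@sub_finite_set _ _ (f @` [set: 'rV['I_(N + N).+1]_d])); last first.
  exact/finite_image/finite_finset.
move=> z /= [w [w_ge0 w_sum zE]].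
have w_le1 i : w 0 i <= 1.
  by rewrite -w_sum (bigD1 i) //= lerDl sumr_ge0.
have zN j : `|z 0 j| <= N%:Z.
  rewrite -(ler_int rat) intr_norm; apply: le_trans BN.
  have -> : (z 0 j)%:~R = \sum_i w 0 i * V i j.
    by have := congr1 (fun M : 'rV_d => M 0 j) zE; rewrite !mxE.
  apply: (le_trans (ler_norm_sum _ _ _)); apply: ler_sum => i _.
  rewrite normrM (ger0_norm (w_ge0 i)).
  apply: (@le_trans _ _ `|V i j|); first by rewrite ler_piMl.
  by rewrite (bigD1 j) //= lerDl sumr_ge0.
exists (\row_j inord (absz (z 0 j + N%:Z))) => //.
apply/rowP=> j; rewrite !mxE inordK.
  rewrite gez0_abs ?addrK //.
  by have := zN j; rewrite ler_norml => /andP[h _]; rewrite -lerBlDr sub0r.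
have := zN j; rewrite ler_norml => /andP[h1 h2].
rewrite ltnS -lez_nat gez0_abs ?PoszD ?lerD2r //.
by rewrite -lerBlDr sub0r.
Qed.

Lemma in_lattice_points (P : lattice_polytope) z :
  (z \in lattice_points P) <-> polytope_set P (map_mx intr z).
Proof.
rewrite in_fset_set ?inE //.
exact/polytope_finite_lattice/lattice_polytope_polytope.
Qed.

Definition sumset (A : {fset 'rV[int]_d}) : {fset 'rV[int]_d} :=
  [fset (x + y)%R | x in A, y in A]%fset.

Definition distinct_pair_sum (P : lattice_polytope) : Prop :=
  let n := #|` lattice_points P| in
  #|` sumset (lattice_points P)| = ('C(n, 2) + n)%N.

Record set_of_moves : Type := SetOfMoves {
  moves :> {fset 'rV[int]_d};
  moves_neq0 : 0 \notin moves;
  moves_sym : moves = [fset (- m)%R | m in moves]%fset;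
  moves_mult : forall (l : nat) m,
    (2 <= l)%N -> m \in moves -> m *+ l \notin moves }.

End Polytopes.

Record simple_graph : Type := SimpleGraph {
  node :> finType;
  adj : rel node;
  adj_sym : symmetric adj;
  adj_irr : irreflexive adj }.

Definition graph_iso (G H : simple_graph) : Prop :=
  exists f : G -> H,
    bijective f /\ forall x y, adj (f x) (f y) = adj x y.

Section FiberGraph.
Variables (d : nat) (P : lattice_polytope d) (M : set_of_moves d).

Definition fiber_adj : rel (lattice_points P) :=
  fun u v => val u - val v \in moves M.

Lemma fiber_adj_sym : symmetric fiber_adj.
Proof.
have MN m : m \in moves M -> - m \in moves M.
  by move=> mM; rewrite moves_sym; apply/imfsetP; exists m.
by move=> u v; apply/idP/idP => /MN; rewrite opprB.
Qed.

Lemma fiber_adj_irr : irreflexive fiber_adj.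
Proof. by move=> u; rewrite /fiber_adj subrr (negbTE (moves_neq0 M)). Qed.

Definition fiber_graph : simple_graph :=
  SimpleGraph fiber_adj_sym fiber_adj_irr.

End FiberGraph.

(* Main.v *)
Require Import Defs.
From mathcomp Require Import all_boot all_order all_algebra finmap.

(** The moves are the differences [u - v] over the edges of the graph that [G]
    induces on the lattice points of [P] through an arbitrary bijection.  Two
    facts make this work.

    In a distinct pair-sum polytope the sums of unordered pairs of lattice
    points are pairwise distinct ([distinct_pair_sum_sidon]), because there are
    as many such pairs as the cardinality of the sumset.  Moving terms across
    the equality, each nonzero difference [u - v] determines [u] and [v]
    ([sidon_differences]), so a difference is a move only if its own two end
    points are joined by an edge: no unwanted edge appears.

    It remains to exclude a move [m] with a proper multiple [l m] that is a
    difference [x - y].  By convexity [y + m] and [x - m] are lattice points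
    of [P] ([lattice_step]), and [(y + m) - y = x - (x - m)].  Uniqueness of
    differences forces [y + m = x], hence [l = 1] ([sidon_no_multiple]). *)

Set Implicit Arguments.
Unset Strict Implicit.
Unset Printing Implicit Defensive.

Import Order.TTheory GRing.Theory Num.Theory.
Local Open Scope ring_scope.

Definition sidon (V : zmodType) (A : {fset V}) : Prop :=
  forall a b c e, a \in A -> b \in A -> c \in A -> e \in A ->
    a + b = c + e -> (a = c /\ b = e) \/ (a = e /\ b = c).

(** The equality of differences reads [a + e = c + b]; the matching of the two
    pairs that would give [a = b] is excluded. *)
Lemma sidon_differences (V : zmodType) (A : {fset V}) (a b c e : V) :
  sidon A -> a \in A -> b \in A -> c \in A -> e \in A ->
  a != b -> a - b = c - e -> a = c /\ b = e.
Proof.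
move=> sidA aA bA cA eA ab abce.
have : a + e = c + b by rewrite -[a](subrK b) abce addrAC subrK.
case/(sidA _ _ _ _ aA eA cA bA) => [[-> ->] // | [abE _]].
by rewrite abE eqxx in ab.
Qed.

Lemma uniq_map_inj_in (T U : eqType) (f : T -> U) (s : seq T) :
  uniq (map f s) -> {in s &, injective f}.
Proof.
move=> us x y xs ys fxy; apply: (@index_inj _ x s) => //.
apply/eqP; rewrite -(nth_uniq (f x) _ _ us) ?size_map ?index_mem //.
by rewrite !(nth_map x) ?index_mem // !nth_index // fxy.
Qed.

(** The pairs of indices [j <= i < n] stand for the unordered pairs of elements
    of [A]; there are ['C(n, 2) + n] of them and their sums exhaust the sumset,
    so equality of cardinals leaves no room for a coincidence. *)
Lemma sumset_card_sidon (d : nat) (A : {fset 'rV[int]_d}) :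
  #|` sumset A| = ('C(#|` A|, 2) + #|` A|)%N -> sidon A.
Proof.
set n := #|` A| => cardA; pose s := enum_fset A.
pose g (p : nat * nat) := s`_p.1 + s`_p.2.
pose D := [seq (i, j) | i <- iota 0 n, j <- iota 0 i.+1].
have memD i j : ((i, j) \in D) = (j <= i < n)%N.
  apply/allpairsPdep/idP => [[i' [j' [+ + [-> ->]]]] | /andP[ji ni]].
    by rewrite !mem_iota /= !add0n ltnS => -> ->.
  by exists i, j; rewrite !mem_iota /= !add0n ltnS.
have sizeD : size D = ('C(n, 2) + n)%N.
  have -> : ('C(n, 2) + n = 'C(n.+1, 2))%N by rewrite binS bin1.
  rewrite size_allpairs_dep -bin2_sum big_nat_recl // add0n sumnE big_map.
  by rewrite /index_iota subn0; apply: eq_bigr => i _; rewrite size_iota.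
have gC i j : g (i, j) = g (j, i) by rewrite /g addrC.
have sizes : size s = n by [].
have idx a : a \in A -> (index a s < n)%N by rewrite -sizes index_mem.
have nthA i : (i < n)%N -> s`_i \in A by move=> ni; exact: mem_nth.
have memS : sumset A =i undup (map g D).
  move=> z; rewrite mem_undup; apply/imfset2P/mapP.
    move=> [x /= xA [y /= yA ->]].
    have [le|/ltnW le] := leqP (index y s) (index x s).
      by exists (index x s, index y s); rewrite ?memD ?le ?idx // /g !nth_index.
    by exists (index y s, index x s); rewrite ?memD ?le ?idx // gC /g !nth_index.
  move=> [[i j]]; rewrite memD => /andP[ji ni] ->.
  by exists s`_i; rewrite ?nthA //; exists s`_j; rewrite ?nthA // (leq_ltn_trans ji).
have uniqD : uniq (map g D).
  rewrite -[uniq _]negbK -ltn_size_undup -leqNgt size_map sizeD -cardA.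
  by rewrite (perm_size (uniq_perm (fset_uniq _) (undup_uniq _) memS)).
pose srt i j := if (j <= i)%N then (i, j) else (j, i).
have srtD i j : (i < n)%N -> (j < n)%N -> srt i j \in D.
  by rewrite /srt; case: (leqP j i) => [ji|/ltnW ij] ni nj;
    rewrite memD ?ji ?ij.
have gsrt a b : a \in A -> b \in A -> g (srt (index a s) (index b s)) = a + b.
  move=> aA bA; have -> : g (srt (index a s) (index b s)) =
      g (index a s, index b s) by rewrite /srt; case: leqP; rewrite // gC.
  by rewrite /g !nth_index.
move=> a b c e aA bA cA eA; rewrite -!gsrt //.
move/(uniq_map_inj_in uniqD (srtD _ _ (idx _ aA) (idx _ bA))
                            (srtD _ _ (idx _ cA) (idx _ eA))).
have nthK x : x \in A -> s`_(index x s) = x by move=> xA; rewrite nth_index.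
by rewrite /srt; case: leqP => _; case: leqP => _ [/(congr1 (nth 0 s)) + /(congr1 (nth 0 s))];
  rewrite !nthK //; [left | right | right | left].
Qed.

Lemma distinct_pair_sum_sidon (d : nat) (P : lattice_polytope d) :
  distinct_pair_sum P -> sidon (lattice_points P).
Proof. exact: sumset_card_sidon. Qed.

Lemma is_polytope_convex (d : nat) (P : classical_sets.set 'rV[rat]_d)
    (x y : 'rV[rat]_d) (t : rat) :
  is_polytope P -> P x -> P y -> 0 <= t <= 1 -> P ((1 - t) *: x + t *: y).
Proof.
move=> [k [V ->]] [w [w0 w1 ->]] [v [v0 v1 ->]] /andP[t0 t1].
exists ((1 - t) *: w + t *: v); split.
- by move=> i; rewrite !mxE addr_ge0 // mulr_ge0 ?subr_ge0.
- under eq_bigr do rewrite !mxE.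
  by rewrite big_split /= -!mulr_sumr w1 v1 !mulr1 subrK.
- by rewrite mulmxDl !scalemxAl.
Qed.

(** [x + m] is the convex combination of [x] and [x + l m] with weight [1 / l]
    on the latter. *)
Lemma lattice_step (d : nat) (P : lattice_polytope d) (x m : 'rV[int]_d)
    (l : nat) :
  (0 < l)%N -> x \in lattice_points P -> x + m *+ l \in lattice_points P ->
  x + m \in lattice_points P.
Proof.
move=> l0 /in_lattice_points xP /in_lattice_points yP; apply/in_lattice_points.
have lr : l%:R != 0 :> rat by rewrite pnatr_eq0 -lt0n.
have -> : map_mx intr (x + m) = (1 - l%:R^-1) *: map_mx intr x
    + l%:R^-1 *: map_mx intr (x + m *+ l) :> 'rV[rat]_d.
  rewrite !map_mxD raddfMn /= scalerDr addrA -scalerDl subrK scale1r.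
  by rewrite -scaler_nat scalerA mulVf // scale1r.
apply: is_polytope_convex => //; first exact: lattice_polytope_polytope.
by rewrite invr_ge0 ler0n invf_le1 ?ler1n ?ltr0n.
Qed.

(** The two end steps [y, y + m] and [x - m, x] of the segment from [y] to [x]
    have the same difference, so they coincide and the segment has a single
    step. *)
Lemma sidon_no_multiple (d : nat) (P : lattice_polytope d) (x y m : 'rV[int]_d)
    (l : nat) :
  sidon (lattice_points P) -> (2 <= l)%N -> m != 0 ->
  x \in lattice_points P -> y \in lattice_points P -> x - y != m *+ l.
Proof.
move=> sidP l2 m0 xP yP; apply/eqP => xy.
have l0 : (0 < l)%N by apply: leq_trans l2.
have ymP : y + m \in lattice_points P.
  by apply: (lattice_step l0 yP); rewrite -xy addrC subrK.
have xmP : x - m \in lattice_points P.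
  by apply: (lattice_step l0 xP); rewrite mulNrn -xy opprB addrC subrK.
have [||ymx _] := sidon_differences sidP ymP yP xP xmP.
- by rewrite -subr_eq0 addrAC subrr add0r.
- by rewrite addrAC subrr add0r subKr.
move: xy; rewrite -ymx addrAC subrr add0r => /rowP ml; case/eqP: m0.
apply/rowP => j; move: (ml j); rewrite mulmxnE mxE -(prednK l0) mulrS.
rewrite -[X in X = _]addr0 => /addrI/esym/eqP.
by rewrite mulrn_eq0 -leqn0 leqNgt -ltnS (prednK l0) l2 => /eqP.
Qed.

Theorem proposition6p3 (d : nat) (P : lattice_polytope d)
    (hP : distinct_pair_sum P)
    (G : simple_graph) (hG : #|G| = #|` lattice_points P|) :
  exists M : set_of_moves d, graph_iso G (fiber_graph P M).
Proof.
have sidP := distinct_pair_sum_sidon hP.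
have cardG : #|G| = #|{: lattice_points P}| by rewrite hG cardfE.
pose f (x : G) : lattice_points P := enum_val (cast_ord cardG (enum_rank x)).
have f_bij : bijective f.
  exists (fun u => enum_val (cast_ord (esym cardG) (enum_rank u))) => u.
    by rewrite /f enum_valK cast_ordK enum_rankK.
  by rewrite /f enum_valK cast_ordKV enum_rankK.
have f_inj := bij_inj f_bij.
have fP x : val (f x) \in lattice_points P by exact: valP.
have f_neq x y : adj x y -> val (f x) != val (f y).
  by move=> xy; rewrite val_eqE (inj_eq f_inj); apply: contraTneq xy => ->;
     rewrite adj_irr.
pose M := [fset z in [seq val (f p.1) - val (f p.2)
                     | p <- enum {: G * G} & adj p.1 p.2]]%fset.
have inM z : reflect (exists x y, adj x y /\ z = val (f x) - val (f y))
                     (z \in M).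
  rewrite in_fset; apply: (iffP mapP) => /=.
    by move=> [[x y]]; rewrite mem_filter => /andP[xy _] ->; exists x, y.
  by move=> [x [y [xy ->]]]; exists (x, y); rewrite // mem_filter xy mem_enum.
have M0 : 0 \notin M.
  apply/inM => -[x [y [/f_neq xy /esym/eqP]]].
  by rewrite subr_eq0 (negbTE xy).
have MN z : z \in M -> - z \in M.
  by move=> /inM[x [y [xy ->]]]; apply/inM; exists y, x; rewrite opprB adj_sym.
have Msym : M = [fset - m | m in M]%fset.
  apply/fsetP => z; apply/idP/imfsetP => [zM | [m /= mM ->]]; last exact: MN.
  by exists (- z); rewrite ?opprK //=; exact: MN.
have Mmult (l : nat) m : (2 <= l)%N -> m \in M -> m *+ l \notin M.
  move=> l2 mM; apply/inM => -[x [y [_ /esym/eqP]]].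
  by apply/negP/(sidon_no_multiple sidP l2) => //; apply: contraNneq M0 => <-.
exists (SetOfMoves M0 Msym Mmult), f; split=> // x y.
apply/inM/idP => [[x' [y' [xy' e]]] | xy]; last by exists x, y.
have [/val_inj/f_inj <- /val_inj/f_inj <- //] :=
  sidon_differences sidP (fP x') (fP y') (fP x) (fP y) (f_neq _ _ xy') (esym e).
Qed.
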